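(* Let $f:\mathcal U\to\mathcal U$ be of the quadratic form $f(u)=Au+B(u,u)$, with $A:\mathcal U\to\mathcal U$ linear and $B:\mathcal U\times\mathcal U\to\mathcal U$ bilinear and symmetric, let $\varphi_1,\dots,\varphi_n\in\mathcal U$ be orthonormal, $\langle\varphi_i,\varphi_j\rangle=\delta_{ij}$, and let $u_0\in\mathcal U$ be the template function. Let $u_{\mathrm{fit}}(t_0),\dots,u_{\mathrm{fit}}(t_{K-1})\in\mathcal U$ be template-fitted snapshots, and define, with exact evaluation of $f$ at the lifted states $P u_{\mathrm{fit}}(t_m)=\sum_{j}\bar a_j(t_m)\varphi_j$, the re-projected data $$\bar a_i(t_m)=\langle u_{\mathrm{fit}}(t_m),\varphi_i\rangle,\qquad \bar v_i(t_m)=\langle f(Pu_{\mathrm{fit}}(t_m)),\varphi_i\rangle,\qquad \bar g(t_m)=\langle f(Pu_{\mathrm{fit}}(t_m)),\partial_xu_0\rangle .$$ Assume that the shared regression matrix, whose $K$ rows (indexed by $m$) are the vectors consisting of the entries $\bar a_j(t_m)$, $1\le j\le n$, followed by the entries $\bar a_j(t_m)\bar a_k(t_m)$, $1\le j\le k\le n$, has full column rank (which requires $K\ge n+\frac{n(n+1)}2$). Then each of the two least-squares problems $$\min_{\hat A,\hat B}\ \sum_{m=0}^{K-1}\sum_{i=1}^n\Big[\sum_j\hat A_{ij}\bar a_j(t_m)+\sum_{j,k}\hat B_{ijk}\bar a_j(t_m)\bar a_k(t_m)-\bar v_i(t_m)\Big]^2,$$ $$\min_{\hat p,\hat Q}\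 \sum_{m=0}^{K-1}\Big[\sum_j\hat p_j\bar a_j(t_m)+\sum_{j,k}\hat Q_{jk}\bar a_j(t_m)\bar a_k(t_m)-\bar g(t_m)\Big]^2$$ (over real coefficients with $\hat B_{ijk}=\hat B_{ikj}$ and $\hat Q_{jk}=\hat Q_{kj}$) has a unique minimizer; these minimizers attain zero residual and equal the symmetry-reduced Galerkin coefficients: $\hat A=\tilde A$, $\hat B=\tilde B$, $\hat p=\tilde p$, $\hat Q=\tilde Q$. Consequently, together with the basis quantities $\tilde C_{ij}$ and $s_j$, the assembled symmetry-reduced operator inference reduced-order model coincides exactly with the symmetry-reduced Galerkin reduced-order model.
   Context: $\mathcal U$ is the space of sufficiently smooth real-valued $L$-periodic functions of $x$, with inner product $\langle v,w\rangle=\frac1L\int_0^Lv(x)w(x)\,dx$. The full-order model is $\partial_tu=f(u)$, where $f$ is shift equivariant: $f(S_\theta v)=S_\theta f(v)$ for all $\theta\in\mathbb R$, $v\in\mathcal U$, with $(S_\theta v)(x)=v(x-\theta)$. The solution is written $u(t)=S_{c(t)}u_{\mathrm{fit}}(t)$, where the shift $c(t)$ is obtained by template fitting, $c(t)\in\arg\min_c\|S_{-c}u(t)-u_0\|^2$, so $u_{\mathrm{fit}}(t_m)=S_{-c(t_m)}u(t_m)$. The $\varphi_i$ are a reduced basis (typically the POD basis computed from the template-fitted snapshots; only orthonormality is assumed), and $Pv=\sum_{i=1}^n\langle v,\varphi_i\rangle\varphi_i$ is the orthogonal projection onto $\mathrm{span}\{\varphi_1,\dots,\varphi_n\}$. Symmetry-reduced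 Galerkin coefficients: $$\tilde A_{ij}=\langle A\varphi_j,\varphi_i\rangle,\quad \tilde B_{ijk}=\langle B(\varphi_j,\varphi_k),\varphi_i\rangle,\quad \tilde p_j=\langle A\varphi_j,\partial_xu_0\rangle,\quad \tilde Q_{jk}=\langle B(\varphi_j,\varphi_k),\partial_xu_0\rangle .$$ Basis quantities (not learned): $\tilde C_{ij}=\langle\partial_x\varphi_j,\varphi_i\rangle$, $s_j=\langle\partial_x\varphi_j,\partial_xu_0\rangle$. The symmetry-reduced Galerkin reduced-order model for $(a(t),c(t))\in\mathbb R^n\times\mathbb R$ is $$\dot a_i=\sum_j\tilde A_{ij}a_j+\sum_{j,k}\tilde B_{ijk}a_ja_k+\dot c\sum_j\tilde C_{ij}a_j,\qquad \dot c=-\frac{\sum_j\tilde p_ja_j+\sum_{j,k}\tilde Q_{jk}a_ja_k}{\sum_js_ja_j}.$$ The symmetry-reduced operator inference reduced-order model is the same system with $\tilde A,\tilde B,\tilde p,\tilde Q$ replaced by the learned $\hat A,\hat B,\hat p,\hat Q$ (and the same $\tilde C$, $s$). Convention: duplicate quadratic monomials $a_ja_k=a_ka_j$ are identified, i.e. the regression uses each monomial once ($j\le k$) and the learned quadratic coefficients are symmetrized in their last two indices. *)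

(* Defs.v *)
From HB Require Import structures.
From mathcomp Require Import all_boot all_order all_algebra.
From mathcomp Require Import all_classical all_reals all_analysis.

Set Implicit Arguments.
Unset Strict Implicit.
Unset Printing Implicit Defensive.

Import Order.TTheory GRing.Theory Num.Theory.
Import numFieldNormedType.Exports.

Local Open Scope classical_set_scope.
Local Open Scope ring_scope.

Section PeriodicFunctions.
Context {R : realType}.

(* A regularity is [Some m] for C^m or [None] for C^infinity. *)
Definition lereg (k : nat) (r : option nat) : bool :=
  if r is Some m then (k <= m)%N else true.

Definition ltreg (k : nat) (r : option nat) : bool :=
  if r is Some m then (k < m)%N else true.

Lemma ltregS (k : nat) (r : option nat) : lereg k.+1 r -> ltreg k r.
Proof. by []. Qed.

Lemma ltregW (k : nat) (r : option nat) : ltreg k r -> lereg k r.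
Proof. by case: r => // m /ltnW. Qed.

Definition Cr (r : option nat) (v : R -> R) : Prop :=
  forall k : nat,
    (lereg k r -> continuous (derive1n k v)) /\
    (ltreg k r -> forall x : R, derivable (derive1n k v) x 1).

Definition periodicCr (L : R) (r : option nat) : {pred R -> R} :=
  mem [set v : R -> R | periodic v L /\ Cr r v].

Lemma periodicCrP (L : R) (r : option nat) (v : R -> R) :
  (v \in periodicCr L r) <-> periodic v L /\ Cr r v.
Proof. by rewrite /periodicCr inE; split. Qed.

Lemma derive1nZD (r : option nat) (a : R) (v w : R -> R) (k : nat) :
  Cr r v -> Cr r w -> lereg k r ->
  derive1n k (a *: v + w) = a *: derive1n k v + derive1n k w.
Proof.
move=> Cv Cw; elim: k => [//|k IH] hk.
have hk' := ltregS hk; have hk'' := ltregW hk'.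
rewrite !derive1nS IH //; apply: funext => x.
have dv := (Cv k).2 hk' x; have dw := (Cw k).2 hk' x.
have daw : derivable (a *: (derive1n k v)) x 1 by exact: derivableZ.
rewrite derive1E deriveD // deriveZ //=.
by rewrite -!derive1E.
Qed.

Lemma periodicCr_submod_closed (L : R) (r : option nat) :
  submod_closed (periodicCr L r).
Proof.
split.
- apply/periodicCrP; split => [x //|k].
  have -> : derive1n k (0 : R -> R) = 0.
    elim: k => [//|k IH]; rewrite derive1nS IH.
    by apply/funext => x; exact: (derive1_cst (0 : R)).
  split=> _ x; first exact: cst_continuous.
  exact: (derivable_cst (0 : R)).
- move=> a v w /periodicCrP[pv Cv] /periodicCrP[pw Cw].
  apply/periodicCrP; split=> [x|k].
    by rewrite !fctE pv pw.
  split=> hk x.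
    rewrite (derive1nZD a Cv Cw hk).
    by apply: cvgD; [apply: cvgZr; exact: (Cv k).1|exact: (Cw k).1].
  rewrite (derive1nZD a Cv Cw (ltregW hk)).
  by apply: derivableD; [apply: derivableZ; exact: (Cv k).2|exact: (Cw k).2].
Qed.

HB.instance Definition _ (L : R) (r : option nat) :=
  GRing.isSubmodClosed.Build R (R -> R) (periodicCr L r)
    (periodicCr_submod_closed L r).

(* The state space of L-periodic functions of class C^r. *)
Record Uspace (L : R) (r : option nat) := MkU {
  Ufun :> R -> R;
  Ufun_in : Ufun \in periodicCr L r }.

HB.instance Definition _ (L : R) (r : option nat) :=
  [isSub for @Ufun L r].
HB.instance Definition _ (L : R) (r : option nat) :=
  [Choice of Uspace L r by <:].
HB.instance Definition _ (L : R) (r : option nat) :=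
  [SubChoice_isSubLmodule of Uspace L r by <:].

Lemma derive1n_shift (theta : R) (v : R -> R) (k : nat) :
  derive1n k (fun x => v (x - theta)) = (fun x => derive1n k v (x - theta)).
Proof.
elim: k => [//|k IH]; rewrite !derive1nS IH; apply/funext => x.
rewrite !derive1E /derive; set F := (X in lim (X @ _)); set G := (X in _ = lim (X @ _)).
suff -> : F = G by [].
by apply: funext => h; rewrite /F /G /= addrA.
Qed.

Lemma shift_periodicCr (L : R) (r : option nat) (theta : R) (v : R -> R) :
  v \in periodicCr L r -> (fun x => v (x - theta)) \in periodicCr L r.
Proof.
move=> /periodicCrP[pv Cv]; apply/periodicCrP; split=> [x|k].
  by rewrite addrAC pv.
rewrite derive1n_shift; split=> hk x.
  apply: (@continuous_comp _ _ _ (fun y => y - theta) (derive1n k v)).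
    by apply: continuousB => //; exact: cst_continuous.
  exact: (Cv k).1.
have := (Cv k).2 hk (x - theta); rewrite /derivable.
set F := (X in cvg (X @ _) -> _); set G := (X in _ -> cvg (X @ _)).
suff -> : G = F by [].
by apply/funext => h; rewrite /F /G /= addrA.
Qed.

Definition shiftU (L : R) (r : option nat) (theta : R) (v : Uspace L r) :
    Uspace L r :=
  MkU (shift_periodicCr theta (Ufun_in v)).

(* Stated on plain functions: the derivative of a C^r function need not lie
   in [Uspace L r] when r is finite. *)
Definition inner (L : R) (v w : R -> R) : R :=
  L^-1 * \int[lebesgue_measure]_(x in `[0, L]) (v x * w x).

Definition normsq (L : R) (v : R -> R) : R := inner L v v.

Definition is_minimizer (T : Type) (D : set T) (J : T -> R) (x : T) : Prop :=
  D x /\ forall y, D y -> J x <= J y.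

(* g'(t) = l, with g restricted to I (one-sided at an endpoint of I) *)
Definition has_deriv_within (I : set R) (g : R -> R) (t l : R) : Prop :=
  (fun s => (g s - g t) / (s - t)) @ within I t^' --> l.

Definition fom_solution (L : R) (r : option nat)
    (f : Uspace L r -> Uspace L r) (I : set R) (u : R -> Uspace L r) : Prop :=
  forall t, I t -> forall x, has_deriv_within I (fun s => u s x) t (f (u t) x).

Definition template_fit (L : R) (r : option nat) (u0 : Uspace L r)
    (I : set R) (u : R -> Uspace L r) (c : R -> R) : Prop :=
  forall t, I t ->
    is_minimizer setT (fun d => normsq L (shiftU (- d) (u t) - u0)) (c t).

Definition span_proj (L : R) (r : option nat) (n : nat) (phi : 'I_n -> Uspace L r)
    (v : Uspace L r) : Uspace L r :=
  \sum_(i < n) inner L v (phi i) *: phi i.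

End PeriodicFunctions.

Section ReducedModels.
Context {R : realType}.

Section Galerkin.
Variables (L : R) (r : option nat) (n : nat).
Variables (A : Uspace L r -> Uspace L r)
  (B : Uspace L r -> Uspace L r -> Uspace L r)
  (phi : 'I_n -> Uspace L r) (u0 : Uspace L r).

Definition galA : 'M[R]_n := \matrix_(i, j) inner L (A (phi j)) (phi i).
Definition galB (i : 'I_n) : 'M[R]_n :=
  \matrix_(j, k) inner L (B (phi j) (phi k)) (phi i).
Definition galp : 'rV[R]_n := \row_j inner L (A (phi j)) (derive1 u0).
Definition galQ : 'M[R]_n :=
  \matrix_(j, k) inner L (B (phi j) (phi k)) (derive1 u0).
Definition basC : 'M[R]_n := \matrix_(i, j) inner L (derive1 (phi j)) (phi i).
Definition bass : 'rV[R]_n := \row_j inner L (derive1 (phi j)) (derive1 u0).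

End Galerkin.

Section Regression.
Variables (K n : nat).

Definition quad_idx : {set 'I_n * 'I_n} :=
  [set jk : 'I_n * 'I_n | (jk.1 <= jk.2)%N].

Definition regression_mx (abar : 'M[R]_(K, n)) : 'M[R]_(K, n + #|quad_idx|) :=
  row_mx abar
    (\matrix_(m < K, l < #|quad_idx|)
       (abar m (enum_val l).1 * abar m (enum_val l).2)).

Definition symB : set ('M[R]_n * ('I_n -> 'M[R]_n)) :=
  [set X : 'M[R]_n * ('I_n -> 'M[R]_n) | forall i j k, X.2 i j k = X.2 i k j].

Definition costAB (abar vbar : 'M[R]_(K, n))
    (X : 'M[R]_n * ('I_n -> 'M[R]_n)) : R :=
  \sum_(m < K) \sum_(i < n)
    (\sum_(j < n) X.1 i j * abar m j
     + \sum_(j < n) \sum_(k < n) X.2 i j k * abar m j * abar m k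
     - vbar m i) ^+ 2.

Definition symQ : set ('rV[R]_n * 'M[R]_n) :=
  [set Y : 'rV[R]_n * 'M[R]_n | forall j k, Y.2 j k = Y.2 k j].

Definition costpQ (abar : 'M[R]_(K, n)) (gbar : 'cV[R]_K)
    (Y : 'rV[R]_n * 'M[R]_n) : R :=
  \sum_(m < K)
    (\sum_(j < n) Y.1 0 j * abar m j
     + \sum_(j < n) \sum_(k < n) Y.2 j k * abar m j * abar m k
     - gbar m 0) ^+ 2.

End Regression.

Record rom (n : nat) := Rom {
  romA : 'M[R]_n;
  romB : 'I_n -> 'M[R]_n;
  romp : 'rV[R]_n;
  romQ : 'M[R]_n;
  romC : 'M[R]_n;
  roms : 'rV[R]_n }.

Section System.
Variables (n : nat) (M : rom n).

Definition rom_den (a : 'rV[R]_n) : R := \sum_(j < n) roms M 0 j * a 0 j.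

(* Right-hand sides of the equations for c and a. *)
Definition rom_cdot (a : 'rV[R]_n) : R :=
  - ((\sum_(j < n) romp M 0 j * a 0 j
      + \sum_(j < n) \sum_(k < n) romQ M j k * a 0 j * a 0 k) / rom_den a).

Definition rom_adot (a : 'rV[R]_n) : 'rV[R]_n :=
  \row_i (\sum_(j < n) romA M i j * a 0 j
          + \sum_(j < n) \sum_(k < n) romB M i j k * a 0 j * a 0 k
          + rom_cdot a * \sum_(j < n) romC M i j * a 0 j).

(* The equation for c only makes sense where its denominator is nonzero. *)
Definition rom_solution (I : set R) (a : R -> 'rV[R]_n) (c : R -> R) : Prop :=
  forall t, I t ->
    [/\ rom_den (a t) != 0,
        forall i, has_deriv_within I (fun s => a s 0 i) t (rom_adot (a t) 0 i)
      & has_deriv_within I c t (rom_cdot (a t))].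

End System.

End ReducedModels.

Arguments symB {R n}.
Arguments symQ {R n}.

(* Main.v *)
(** Pairing [f] at a lifted state [\sum_j a_j phi_j] with any fixed continuous
    function gives a polynomial in [a] whose linear and quadratic coefficients
    are the Galerkin ones, so these reproduce the re-projected data with zero
    residual.  A minimizer therefore has zero residual too, and its difference
    from the Galerkin coefficients, written on the monomials [a_j a_k] with
    [j <= k], lies in the kernel of the regression matrix, which is trivial. *)
Require Import Defs.
From HB Require Import structures.
From mathcomp Require Import all_boot all_order all_algebra.
From mathcomp Require Import all_classical all_reals all_analysis.
Import Order.TTheory GRing.Theory Num.Theory.
Import numFieldNormedType.Exports.
Local Open Scope classical_set_scope.
Local Open Scope ring_scope.

(** Grouping the pairs by their larger entry [k] leaves [k + 1] choices for the smaller one, a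
    triangular sum. *)
Lemma card_quad_idx (n : nat) : #|quad_idx n| = ((n * n.+1) %/ 2)%N.
Proof.
have -> : #|quad_idx n| = (\sum_(k < n) k.+1)%N.
  rewrite -sum1_card (eq_bigl (fun jk : 'I_n * 'I_n => jk.1 <= jk.2)%N); last first.
    by move=> jk; rewrite inE.
  rewrite -(pair_big_dep predT (fun j k : 'I_n => j <= k)%N (fun _ _ => 1%N)) /=.
  rewrite (exchange_big_dep predT) //=; apply: eq_bigr => k _.
  by rewrite -(big_ord_widen _ (fun=> 1%N) (ltn_ord k)) sum1_card card_ord.
have := bin2_sum n.+1.
rewrite big_mkord big_ord_recl add0n => ->.
by rewrite bin2 /= mulnC divn2.
Qed.

(** * Quadratic models and their identification from data *)

Section QuadraticModel.
Context {R : realType}.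

(** The shape shared by each row [i] of the first fit and by the second fit. Coefficients are plain
    functions, so that matrix rows and inner products can both be supplied. *)
Definition quad_model {n : nat} (p : 'I_n -> R) (Q : 'I_n -> 'I_n -> R)
    (a : 'I_n -> R) : R :=
  \sum_(j < n) p j * a j + \sum_(j < n) \sum_(k < n) Q j k * a j * a k.

Lemma quad_modelB {n : nat} (p p' : 'I_n -> R) (Q Q' : 'I_n -> 'I_n -> R)
    (a : 'I_n -> R) :
  quad_model (fun j => p j - p' j) (fun j k => Q j k - Q' j k) a
  = quad_model p Q a - quad_model p' Q' a.
Proof.
rewrite /quad_model opprD addrACA -!sumrB; congr (_ + _); apply: eq_bigr => j _.
  by rewrite mulrBl.
by rewrite -sumrB; apply: eq_bigr => k _; rewrite !mulrBl.
Qed.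

(* Merging [a j * a k] with [a k * a j] doubles the off-diagonal coefficients. *)
Definition monomial_coef {n : nat} (Q : 'I_n -> 'I_n -> R) (jk : 'I_n * 'I_n) : R :=
  if jk.1 == jk.2 then Q jk.1 jk.2 else Q jk.1 jk.2 *+ 2.

(** Swapping coordinates carries the pairs with [j > k] onto those with [j < k], where symmetry of
    [Q] makes the two terms equal. *)
Lemma quad_form_monomials {n : nat} (Q : 'I_n -> 'I_n -> R) (a : 'I_n -> R)
    (Qsym : forall j k, Q j k = Q k j) :
  \sum_(j < n) \sum_(k < n) Q j k * a j * a k
  = \sum_(jk in quad_idx n) monomial_coef Q jk * (a jk.1 * a jk.2).
Proof.
rewrite pair_bigA (bigID (mem (quad_idx n))) /=.
rewrite [X in _ + X](reindex_inj (h := fun jk => (jk.2, jk.1))); last first.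
  by move=> [j k] [j' k'] /= [-> ->].
rewrite [X in _ + X](eq_bigl (fun jk => (jk \in quad_idx n) && (jk.1 != jk.2))); last first.
  by case=> j k; rewrite !inE /= -ltnNge ltn_neqAle andbC.
(* The strictness condition becomes a conditional summand, so both sums range over [quad_idx] and
   add termwise. *)
rewrite [X in _ + X]big_mkcondr /= -big_split /=; apply: eq_big => -[j k] //= _.
rewrite /monomial_coef /=; case: eqVneq => [->|_] /=; first by rewrite addr0 mulrA.
by rewrite (Qsym k j) mulr2n mulrDl mulrA -[_ * a k * a j]mulrA (mulrC (a k)) mulrA.
Qed.

Lemma quad_model_regression {K n : nat} (abar : 'M[R]_(K, n))
    (p : 'I_n -> R) (Q : 'I_n -> 'I_n -> R)
    (Qsym : forall j k, Q j k = Q k j) (m : 'I_K) :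
  quad_model p Q (abar m)
  = (regression_mx abar *m
     col_mx (\col_j p j) (\col_l monomial_coef Q (enum_val l))) m 0.
Proof.
rewrite /regression_mx mul_row_col !mxE /quad_model quad_form_monomials //.
congr (_ + _); first by apply: eq_bigr => j _; rewrite !mxE mulrC.
rewrite [LHS]big_enum_val; apply: eq_bigr => l _.
by rewrite !mxE [LHS]mulrC.
Qed.

(** The merged coefficients determine a symmetric [Q]: the factor 2 off the diagonal cancels, and
    symmetry recovers the entries with [j > k]. *)
Lemma quad_model_inj {K n : nat} (abar : 'M[R]_(K, n))
    (p p' : 'I_n -> R) (Q Q' : 'I_n -> 'I_n -> R)
    (hrank : \rank (regression_mx abar) = (n + #|quad_idx n|)%N)
    (Qsym : forall j k, Q j k = Q k j) (Qsym' : forall j k, Q' j k = Q' k j)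
    (heq : forall m, quad_model p Q (abar m) = quad_model p' Q' (abar m)) :
  (forall j, p j = p' j) /\ (forall j k, Q j k = Q' j k).
Proof.
pose q j := p j - p' j; pose S j k := Q j k - Q' j k.
have Ssym j k : S j k = S k j by rewrite /S Qsym Qsym'.
(* [row_free] cancels a factor acting on row vectors, hence the transpose. *)
have hfree : row_free (regression_mx abar)^T by rewrite /row_free mxrank_tr hrank.
have : col_mx (\col_j q j) (\col_l monomial_coef S (enum_val l)) = 0 :> 'cV_(n + #|quad_idx n|).
  apply: trmx_inj; apply: (row_free_inj hfree).
  rewrite -trmx_mul trmx0 mul0mx; apply/rowP => m.
  by rewrite mxE [RHS]mxE -quad_model_regression // quad_modelB heq subrr.
move/eqP; rewrite col_mx_eq0 => /andP[/eqP q0 /eqP S0]; split=> [j|].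
  by apply/eqP; rewrite -subr_eq0; move/colP/(_ j): q0; rewrite !mxE => /eqP.
have Sle (j k : 'I_n) : (j <= k)%N -> S j k = 0.
  move=> jk; have jkI : (j, k) \in quad_idx n by rewrite inE.
  move/colP/(_ (enum_rank_in jkI (j, k))): S0; rewrite !mxE enum_rankK_in //.
  rewrite /monomial_coef /=; case: ifP => // _ /eqP.
  by rewrite mulrn_eq0 => /eqP.
move=> j k; apply/eqP; rewrite -subr_eq0; apply/eqP; rewrite -/(S j k).
by case/orP: (leq_total j k) => [|kj]; [exact: Sle|rewrite Ssym Sle].
Qed.

(** Zero is a lower bound attained at [x0], so the minimizers are exactly the zeros of [J] in
    [D]. *)
Lemma zero_residual_minimizer {T : Type} (D : set T) (J : T -> R) (x0 : T)
    (J_ge0 : forall x, 0 <= J x) (Dx0 : D x0) (Jx0 : J x0 = 0)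
    (J_inj : forall x, D x -> J x = 0 -> x = x0) :
  (exists! x, is_minimizer D J x) /\
  (forall x, is_minimizer D J x -> J x = 0 /\ x = x0).
Proof.
have min0 x : is_minimizer D J x -> J x = 0 /\ x = x0.
  case=> Dx Jmin; have Jx : J x = 0.
    by apply/eqP; rewrite eq_le J_ge0 -Jx0 Jmin.
  by split=> //; exact: J_inj.
split=> //; exists x0; split=> [|x /min0[_ ->] //].
by split=> // y _; rewrite Jx0.
Qed.

End QuadraticModel.

(** * Pairing with a continuous function as a linear functional *)

Section InnerProduct.
Context {R : realType} {L : R} {r : option nat}.

Lemma Uspace_continuous (v : Uspace L r) : continuous v.
Proof.
have /periodicCrP[_ /(_ 0%N)[+ _]] := Ufun_in v.
by apply; case: (r).
Qed.

(** Beyond C^0 the derivative of the template is continuous, so it can serve as a test function. *)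
Lemma Uspace_derive1_continuous (v : Uspace L r) :
  r != Some 0%N -> continuous (derive1 v).
Proof.
move=> r0; have /periodicCrP[_ /(_ 1%N)[+ _]] := Ufun_in v.
rewrite derive1n1; apply; by move: r0; case: (r) => // -[].
Qed.

Lemma integrable_mul (v w : R -> R) : continuous v -> continuous w ->
  lebesgue_measure.-integrable `[0, L] (EFin \o (fun x => v x * w x)).
Proof.
move=> cv cw; apply: continuous_compact_integrable; first exact: segment_compact.
by apply: continuous_subspaceT => x; apply: continuousM; [exact: cv|exact: cw].
Qed.

(** [w] is a continuous function rather than a state, which covers both [phi i] and [derive1 u0]. *)
Lemma inner_linearl (w : R -> R) : continuous w ->
  linear (fun v : Uspace L r => inner L v w : R^o).
Proof.
move=> cw a v v'.
have cv := Uspace_continuous v; have cv' := Uspace_continuous v'.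
have cav : continuous (fun x => a * v x) by exact: (Uspace_continuous (a *: v)).
rewrite /inner (_ : \int[_]_(x in _) _ = \int[lebesgue_measure]_(x in `[0, L])
  (a * (v x * w x) + v' x * w x)); last first.
  by apply: eq_Rintegral => x _; rewrite /= mulrDl mulrA.
rewrite RintegralD //; last exact: integrable_mul; last first.
  rewrite (_ : (fun _ => _) = fun x => (a * v x) * w x); first exact: integrable_mul.
  by apply/funext => x; rewrite mulrA.
rewrite RintegralZl //; last exact: integrable_mul.
by rewrite mulrDr mulrCA.
Qed.

(** The continuity proof is an argument so that a linear structure can be attached. *)
Definition innerl (w : R -> R) (cw : continuous w) (v : Uspace L r) : R^o :=
  inner L v w.

HB.instance Definition _ (w : R -> R) (cw : continuous w) :=
  GRing.isLinear.Build R (Uspace L r) R^o *:%R (innerl w cw) (inner_linearl w cw).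

(** Expansion by (bi)linearity; keeping [ell] abstract lets one computation serve every test
    function. *)
Lemma linear_galerkin (A : {linear Uspace L r -> Uspace L r})
    (B : {bilinear Uspace L r -> Uspace L r -> Uspace L r})
    (ell : {linear Uspace L r -> R^o})
    (n : nat) (phi : 'I_n -> Uspace L r) (a : 'I_n -> R) :
  let v := \sum_(i < n) a i *: phi i in
  ell (A v + B v v)
  = quad_model (fun j => ell (A (phi j))) (fun j k => ell (B (phi j) (phi k))) a.
Proof.
rewrite /= linearD /quad_model; congr (_ + _).
  rewrite 2!linear_sum; apply: eq_bigr => j _.
  by rewrite !linearZ mulrC.
rewrite linear_sumlz linear_sum; apply: eq_bigr => j _.
rewrite linear_sumr linear_sum; apply: eq_bigr => k _.
rewrite linearZr_LR linearZl_LR !linearZ /=.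
by rewrite mulrC [a j *: _]mulrC.
Qed.

Lemma inner_galerkin (A : {linear Uspace L r -> Uspace L r})
    (B : {bilinear Uspace L r -> Uspace L r -> Uspace L r})
    (f : Uspace L r -> Uspace L r) (hf : forall v, f v = A v + B v v)
    (n : nat) (phi : 'I_n -> Uspace L r) (v : Uspace L r)
    (w : R -> R) (cw : continuous w) :
  inner L (f (span_proj phi v)) w
  = quad_model (fun j => inner L (A (phi j)) w)
      (fun j k => inner L (B (phi j) (phi k)) w) (fun i => inner L v (phi i)).
Proof. by rewrite hf; exact: (linear_galerkin A B (innerl w cw)). Qed.

End InnerProduct.

Theorem corollaryA6 (R : realType) (L : R) (hL : 0 < L)
  (r : option nat) (hr : r != Some 0%N)
  (* full-order model *)
  (A : {linear Uspace L r -> Uspace L r})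
  (B : {bilinear Uspace L r -> Uspace L r -> Uspace L r})
  (hB : forall v w, B v w = B w v)
  (f : Uspace L r -> Uspace L r)
  (hf : forall v, f v = A v + B v v)
  (hequiv : forall (theta : R) (v : Uspace L r),
      f (shiftU theta v) = shiftU theta (f v))
  (* reduced basis and template *)
  (n : nat) (phi : 'I_n -> Uspace L r)
  (hphi : forall i j, inner L (phi i) (phi j) = (i == j)%:R)
  (u0 : Uspace L r)
  (* full-order solution, template-fitting shift and snapshots *)
  (I : set R) (hI : is_interval I) (hI0 : I° !=set0)
  (u : R -> Uspace L r) (hu : fom_solution f I u)
  (c : R -> R) (hc : template_fit u0 I u c)
  (K : nat) (time : 'I_K -> R) (htime : forall m, I (time m))
  (ufit : 'I_K -> Uspace L r)
  (hufit : forall m, ufit m = shiftU (- c (time m)) (u (time m)))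
  (* re-projected data *)
  (abar vbar : 'M[R]_(K, n)) (gbar : 'cV[R]_K)
  (habar : forall m i, abar m i = inner L (ufit m) (phi i))
  (hvbar : forall m i, vbar m i = inner L (f (span_proj phi (ufit m))) (phi i))
  (hgbar : forall m, gbar m 0 = inner L (f (span_proj phi (ufit m))) (derive1 u0))
  (hrank : \rank (regression_mx abar) = (n + #|quad_idx n|)%N) :
  [/\ (n + (n * n.+1) %/ 2 <= K)%N,
      (exists! X, is_minimizer symB (costAB abar vbar) X) /\
      (forall Ahat Bhat,
         is_minimizer symB (costAB abar vbar) (Ahat, Bhat) ->
         [/\ costAB abar vbar (Ahat, Bhat) = 0,
             Ahat = galA A phi & Bhat = galB B phi]),
      (exists! Y, is_minimizer symQ (costpQ abar gbar) Y) /\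
      (forall phat Qhat,
         is_minimizer symQ (costpQ abar gbar) (phat, Qhat) ->
         [/\ costpQ abar gbar (phat, Qhat) = 0,
             phat = galp A phi u0 & Qhat = galQ B phi u0])
    & forall Ahat Bhat phat Qhat,
        is_minimizer symB (costAB abar vbar) (Ahat, Bhat) ->
        is_minimizer symQ (costpQ abar gbar) (phat, Qhat) ->
        let opinf_rom := Rom Ahat Bhat phat Qhat (basC phi) (bass phi u0) in
        let galerkin_rom :=
          Rom (galA A phi) (galB B phi) (galp A phi u0) (galQ B phi u0)
              (basC phi) (bass phi u0) in
        [/\ forall a, rom_adot opinf_rom a = rom_adot galerkin_rom a,
            forall a, rom_cdot opinf_rom a = rom_cdot galerkin_rom a
          & forall (J : set R) (a : R -> 'rV[R]_n) (d : R -> R),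
              rom_solution opinf_rom J a d <-> rom_solution galerkin_rom J a d]].

Proof.
have dataE m w : continuous w -> inner L (f (span_proj phi (ufit m))) w
    = quad_model (fun j => inner L (A (phi j)) w)
        (fun j k => inner L (B (phi j) (phi k)) w) (abar m).
  move=> cw; rewrite (inner_galerkin A B) //; congr quad_model.
  by apply/funext => i; rewrite habar.
(* With the data replaced by Galerkin model values, the cost compares two quadratic models. *)
have costABE X : costAB abar vbar X = \sum_(m < K) \sum_(i < n)
    (quad_model (X.1 i) (X.2 i) (abar m)
     - quad_model (galA A phi i) (galB B phi i) (abar m)) ^+ 2.
  apply: eq_bigr => m _; apply: eq_bigr => i _; congr ((_ - _) ^+ 2).
  rewrite hvbar dataE; last exact: Uspace_continuous.
  by congr quad_model; apply/funext => j; [|apply/funext => k]; rewrite mxE.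
have costpQE Y : costpQ abar gbar Y = \sum_(m < K)
    (quad_model (Y.1 0) (Y.2) (abar m)
     - quad_model (galp A phi u0 0) (galQ B phi u0) (abar m)) ^+ 2.
  apply: eq_bigr => m _; congr ((_ - _) ^+ 2).
  rewrite hgbar dataE; last exact: Uspace_derive1_continuous.
  by congr quad_model; apply/funext => j; [|apply/funext => k]; rewrite mxE.
(* Symmetry of [B] makes the Galerkin coefficients admissible in both problems. *)
have galB_sym i j k : galB B phi i j k = galB B phi i k j by rewrite !mxE hB.
have galQ_sym j k : galQ B phi u0 j k = galQ B phi u0 k j by rewrite !mxE hB.
have [AB_uniq AB_min] : (exists! X, is_minimizer symB (costAB abar vbar) X) /\
    (forall X, is_minimizer symB (costAB abar vbar) X ->
       costAB abar vbar X = 0 /\ X = (galA A phi, galB B phi)).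
  apply: zero_residual_minimizer => //.
  - by move=> X; apply: sumr_ge0 => m _; apply: sumr_ge0 => i _; exact: sqr_ge0.
  - by rewrite costABE big1 // => m _; rewrite big1 // => i _; rewrite subrr expr0n.
  move=> [X1 X2] Xsym; rewrite costABE => J0.
  (* The rows decouple: every square vanishes, so for each fixed [i] the two models agree on all
     snapshots. *)
  have eqX i : (forall j, X1 i j = galA A phi i j) /\
      (forall j k, X2 i j k = galB B phi i j k).
    apply: (quad_model_inj abar) => // m.
    apply/eqP; rewrite -subr_eq0 -sqrf_eq0; apply/eqP.
    have Jm := @psumr_eq0P _ _ xpredT _ (fun m _ => sumr_ge0 _ (fun i _ => sqr_ge0 _)) J0 m isT.
    exact: (@psumr_eq0P _ _ xpredT _ (fun i _ => sqr_ge0 _) Jm i isT).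
  congr pair; first by apply/matrixP => i j; exact: (eqX i).1.
  by apply/funext => i; apply/matrixP => j k; exact: (eqX i).2.
have [pQ_uniq pQ_min] : (exists! Y, is_minimizer symQ (costpQ abar gbar) Y) /\
    (forall Y, is_minimizer symQ (costpQ abar gbar) Y ->
       costpQ abar gbar Y = 0 /\ Y = (galp A phi u0, galQ B phi u0)).
  apply: zero_residual_minimizer => //.
  - by move=> Y; apply: sumr_ge0 => m _; exact: sqr_ge0.
  - by rewrite costpQE big1 // => m _; rewrite subrr expr0n.
  move=> [p Q] Ysym; rewrite costpQE => J0.
  have [eqp eqQ] : (forall j, p 0 j = galp A phi u0 0 j) /\
      (forall j k, Q j k = galQ B phi u0 j k).
    apply: (quad_model_inj abar) => // m.
    apply/eqP; rewrite -subr_eq0 -sqrf_eq0; apply/eqP.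
    exact: (@psumr_eq0P _ _ xpredT _ (fun m _ => sqr_ge0 _) J0 m isT).
  congr pair; first by apply/rowP => j; exact: eqp.
  by apply/matrixP => j k; exact: eqQ.
split.
(* The rank cannot exceed the number [K] of rows. *)
- by rewrite -card_quad_idx -hrank rank_leq_row.
- by split=> // Ahat Bhat /AB_min[-> [-> ->]].
- by split=> // phat Qhat /pQ_min[-> [-> ->]].
(* After substitution the two reduced models are the same term. *)
by move=> Ahat Bhat phat Qhat /AB_min[_ [-> ->]] /pQ_min[_ [-> ->]].
Qed.
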